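(* Let $d\ge p\ge1$ and $n\ge1$ be integers, let $A\in\mathbb{R}^{d\times p}$, let $B\in\mathbb{R}^{dp\times dp}$ be symmetric, and let $\Omega\in\mathbb{R}^{dp\times dp}$ be symmetric positive definite. Let $X_1,\ldots,X_n$ be a random sample on the Stiefel manifold $V_{d,p}$, let $P_0$ be the Fisher-Bingham distribution on $V_{d,p}$ with density $g_0(\cdot;A,B)$, and let the weight function be $w(\cdot;\Omega)$. Put $a=\mathrm{vec}(A)$. Then the quantities $U_{n,1;\Omega}$ and $U_{n,2;\Omega}$ defined in the context satisfy $$U_{n,1;\Omega}=\frac{1}{n^2}\sum_{j,k=1}^n\exp\left(-\tfrac12\mathrm{vec}(X_j-X_k)'\,\Omega\,\mathrm{vec}(X_j-X_k)\right),$$ $$U_{n,2;\Omega}=\frac{1}{n\,\Psi(A,B)}\sum_{j=1}^n\exp\left(-\tfrac12\mathrm{vec}(X_j)'\,\Omega\,\mathrm{vec}(X_j)\right)\Psi_{\mathrm{vec}}\left(a+\Omega\,\mathrm{vec}(X_j),\,B-\tfrac12\Omega\right).$$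
   Context: $V_{d,p}=\{x\in\mathbb{R}^{d\times p}:x'x=I_p\}$; $\eta$ is the normalized Haar measure on $V_{d,p}$ (the unique probability measure invariant under $x\mapsto Qx$, $Q\in O(d)$); $\mathrm{vec}$ stacks the columns of a matrix from left to right into a vector; $M'$ is the transpose. For $A\in\mathbb{R}^{d\times p}$ and symmetric $B\in\mathbb{R}^{dp\times dp}$, $$\Psi(A,B)=\int_{V_{d,p}}\exp\left(\mathrm{tr}(A'v)+\mathrm{vec}(v)'B\,\mathrm{vec}(v)\right)\mathrm{d}\eta(v),\qquad \Psi_{\mathrm{vec}}(\mathrm{vec}(A),B)=\Psi(A,B),$$ and the Fisher-Bingham distribution has density, with respect to $\eta$, $g_0(x;A,B)=\Psi(A,B)^{-1}\exp(\mathrm{tr}(A'x)+\mathrm{vec}(x)'B\,\mathrm{vec}(x))$, $x\in V_{d,p}$. The weight function on $\mathbb{R}^{d\times p}$ is $$w(t;\Omega)=(2\pi)^{-dp/2}\det(\Omega)^{-1/2}\exp\left(-\tfrac12\mathrm{vec}(t)'\Omega^{-1}\mathrm{vec}(t)\right).$$ With $\varphi_0(t)=\int\exp(\mathrm{i}\,\mathrm{tr}(t'x))\,\mathrm{d}P_0(x)$ and $\varphi_n(t)=\frac1n\sum_{j=1}^n\exp(\mathrm{i}\,\mathrm{tr}(t'X_j))$, $$U_{n,1;\Omega}=\int_{\mathbb{R}^{d\times p}}|\varphi_n(t)|^2w(t;\Omega)\,\mathrm{d}t,\qquad U_{n,2;\Omega}=\mathrm{Re}\int_{\mathbb{R}^{d\times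 p}}\varphi_0(t)\overline{\varphi_n(t)}\,w(t;\Omega)\,\mathrm{d}t.$$ *)

(* Defs.v *)
From HB Require Import structures.
From mathcomp Require Import all_boot all_order all_algebra.
From mathcomp Require Import complex.
From mathcomp Require Import all_classical all_reals all_analysis.

Set Implicit Arguments.
Unset Strict Implicit.
Unset Printing Implicit Defensive.

Import Order.TTheory GRing.Theory Num.Theory.
Import numFieldNormedType.Exports.

Local Open Scope classical_set_scope.
Local Open Scope ring_scope.

Section Vec.
Context {R : pzRingType} {d p : nat}.

(* [mxvec] is row-major, so the transpose is needed to stack columns; as a
   consequence d x p matrices are vectorized into dimension [p * d]. *)
Definition vec (M : 'M[R]_(d, p)) : 'cV[R]_(p * d) := (mxvec M^T)^T.

Definition unvec (u : 'cV[R]_(p * d)) : 'M[R]_(d, p) := (vec_mx u^T)^T.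

Lemma vecK : cancel vec unvec.
Proof. by move=> M; rewrite /vec /unvec trmxK mxvecK trmxK. Qed.

Lemma unvecK : cancel unvec vec.
Proof. by move=> u; rewrite /vec /unvec trmxK vec_mxK trmxK. Qed.

Definition qform {k : nat} (B : 'M[R]_k) (u : 'cV[R]_k) : R :=
  (u^T *m B *m u) 0 0.

End Vec.

Definition posdefmx {R : realType} {k : nat} (B : 'M[R]_k) : Prop :=
  forall u : 'cV[R]_k, u != 0 -> 0 < qform B u.

(* Borel sigma-algebra on real matrices. *)
HB.instance Definition _ (R : realType) (m n : nat) :=
  @isMeasurable.Build (sigma_display (@open 'M[R]_(m, n))) 'M[R]_(m, n)
    <<s @open 'M[R]_(m, n) >> (@sigma_algebra0 _ setT _)
    (@sigma_algebraC _ _) (@sigma_algebra_bigcup _ setT _).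

Lemma measurable_fun_mx {q} {T : measurableType q} {R : realType} {m n : nat}
    (f : T -> 'M[R]_(m, n)) :
  (forall i j, measurable_fun setT (fun x => f x i j)) ->
  measurable_fun setT f.
Proof.
move=> mf; apply: (@measurability _ _ _ _ _ _ (@open 'M[R]_(m, n))) => //.
move=> _ [U oU <-]; rewrite setTI.
pose ballQ (c : 'M[rat]_(m, n) * nat) : set 'M[R]_(m, n) :=
  ball (map_mx (@ratr R) c.1) c.2.+1%:R^-1.
have -> : f @^-1` U =
    \bigcup_c (if `[< ballQ c `<=` U >] then f @^-1` ballQ c else set0).
  apply/seteqP; split => [x Ufx|x [c _]]; last first.
    by case: ifPn => // /asboolP + ?; exact.
  have /nbhs_ballP[e /= e0 feU] : nbhs (f x) U.
    by move: oU; rewrite openE => /(_ _ Ufx).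
  have [k ke] : exists k : nat, k.+1%:R^-1 < e / 2.
    have [k _ /(_ k (leqnn k)) ke] := near_infty_natSinv_lt (PosNum (divr_gt0 e0 (ltr0Sn R 1))).
    by exists k.
  have k0 : (0 : R) < k.+1%:R^-1 by rewrite invr_gt0.
  have cx i j : exists r : rat, ball (ratr r : R) k.+1%:R^-1 (f x i j).
    have /rat_in_itvoo[r] : f x i j - k.+1%:R^-1 < f x i j + k.+1%:R^-1.
      by rewrite ltrBlDr -addrA ltrDl addr_gt0.
    rewrite in_itv/= => /andP[r1 r2]; exists r.
    by rewrite /ball/= ltr_distl r1 r2.
  pose c := \matrix_(i, j) sval (cid (cx i j)).
  have cfx : ballQ (c, k) (f x).
    by split => // i j; rewrite !mxE /=; case: cid.
  exists (c, k) => //; rewrite ifT //; apply/asboolP => y cy.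
  apply: feU; apply: le_ball (ball_triangle (ball_sym cfx) cy).
  by rewrite (splitr e) lerD// ltW.
apply: countable_bigcupT_measurable => // c; case: ifPn => // _.
have -> : f @^-1` ballQ c = \bigcap_(ij in [set: 'I_m * 'I_n])
    (fun x => f x ij.1 ij.2) @^-1` ball (ratr (c.1 ij.1 ij.2) : R) c.2.+1%:R^-1.
  apply/seteqP; split => x /=.
    by move=> [_ cx] [i j] _ /=; have := cx i j; rewrite mxE.
  by move=> cx; split; [rewrite invr_gt0|move=> i j; have := cx (i, j) I; rewrite mxE].
apply: fin_bigcap_measurable; first exact: finite_finset.
move=> ij _; rewrite -[X in measurable X]setTI.
by apply: mf => //; rewrite ball_itv; exact: measurable_itv.
Qed.

Definition image_measure {d1 d2} {T1 : measurableType d1}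
    {T2 : measurableType d2} {R : realType} (mu : {measure set T1 -> \bar R})
    {f : T1 -> T2} (mf : measurable_fun setT f) :
    {measure set T2 -> \bar R} :=
  measure_function_pushforward__canonical__measure_function_Measure mu mf.

Section LebesgueMatrix.
Context {R : realType}.

Lemma measurable_cons_prod n :
  measurable_fun [set: n.-tuple (measurableTypeR R) * measurableTypeR R]
    (fun x => [the n.+1.-tuple (measurableTypeR R) of x.2 :: x.1]).
Proof. exact: measurable_cons. Qed.

(* Lebesgue measure on R^n, as the n-fold product of the Lebesgue measure. *)
Fixpoint lebesgue_tuple (n : nat) :
    {measure set (n.-tuple (measurableTypeR R)) -> \bar R} :=
  if n is m.+1 then
    image_measure (lebesgue_tuple m \x (@lebesgue_measure R))%E
      (@measurable_cons_prod m)
  else \d_ [tuple].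

Definition unvec_tuple {d p : nat} (s : (p * d).-tuple (measurableTypeR R)) :
  'M[R]_(d, p) := unvec (\col_i tnth s i).

Lemma measurable_unvec_tuple d p : measurable_fun setT (@unvec_tuple d p).
Proof.
apply: measurable_fun_mx => i j; rewrite /unvec_tuple /unvec.
under eq_fun do rewrite !mxE.
exact: measurable_tnth.
Qed.

Definition lebesgue_mx (d p : nat) : {measure set 'M[R]_(d, p) -> \bar R} :=
  image_measure (lebesgue_tuple (p * d)) (@measurable_unvec_tuple d p).

End LebesgueMatrix.

Section ComplexAnalysis.
Context {R : realType}.

Definition cexp (z : R[i]) : R[i] :=
  Complex (expR (complex.Re z) * cos (complex.Im z))
          (expR (complex.Re z) * sin (complex.Im z)).

Definition Cintegral {q} {T : measurableType q} (mu : {measure set T -> \bar R})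
    (D : set T) (f : T -> R[i]) : R[i] :=
  Complex (\int[mu]_(x in D) complex.Re (f x))
          (\int[mu]_(x in D) complex.Im (f x)).

End ComplexAnalysis.

Section FisherBingham.
Context {R : realType} {d p : nat}.
Local Notation M := 'M[R]_(d, p).

Definition stiefel : set M := [set x | x^T *m x = 1%:M].

(* Normalized Haar measure on the Stiefel manifold, seen as a Borel
   probability on the ambient matrix space that is carried by [stiefel]. *)
Definition is_stiefel_haar (eta : probability M R) : Prop :=
  eta stiefel = 1%E /\
  forall Q : 'M[R]_d, Q^T *m Q = 1%:M ->
  forall S : set M, measurable S -> eta ((fun x => Q *m x) @^-1` S) = eta S.

Definition fb_kernel (A : M) (B : 'M[R]_(p * d)) (x : M) : R :=
  expR (\tr (A^T *m x) + qform B (vec x)).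

Definition Psi (eta : probability M R) (A : M) (B : 'M[R]_(p * d)) : R :=
  \int[eta]_(v in stiefel) fb_kernel A B v.

Definition Psi_vec (eta : probability M R) (a : 'cV[R]_(p * d))
  (B : 'M[R]_(p * d)) : R := Psi eta (unvec a) B.

Definition fb_density (eta : probability M R) (A : M) (B : 'M[R]_(p * d))
  (x : M) : R := (Psi eta A B)^-1 * fb_kernel A B x.

Definition is_fisher_bingham (eta : probability M R) (A : M)
    (B : 'M[R]_(p * d)) (P0 : probability M R) : Prop :=
  forall S : set M, measurable S ->
    P0 S = (\int[eta]_(x in stiefel `&` S) (fb_density eta A B x)%:E)%E.

Definition weight (Omega : 'M[R]_(p * d)) (t : M) : R :=
  (2 * pi) `^ (- ((d * p)%:R / 2)) * \det Omega `^ (- 2^-1) *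
  expR (- 2^-1 * qform (invmx Omega) (vec t)).

Definition phi0 (P0 : probability M R) (t : M) : R[i] :=
  Cintegral P0 setT (fun x => cexp ('i%C * (\tr (t^T *m x))%:C%C)).

Definition phin {n} (x : 'I_n -> M) (t : M) : R[i] :=
  n%:R^-1 * \sum_(j < n) cexp ('i%C * (\tr (t^T *m x j))%:C%C).

Definition U1 {n} (Omega : 'M[R]_(p * d)) (x : 'I_n -> M) : R :=
  \int[lebesgue_mx d p]_t (ComplexField.Normc.normc (phin x t) ^+ 2 * weight Omega t).

Definition U2 {n} (Omega : 'M[R]_(p * d)) (P0 : probability M R)
    (x : 'I_n -> M) : R :=
  complex.Re (Cintegral (lebesgue_mx d p) setT
    (fun t => phi0 P0 t * conjc (phin x t) * (weight Omega t)%:C%C)).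

End FisherBingham.

Section RandomSample.
Context {q} {T : measurableType q} {R : realType} (P : probability T R).
Context {q'} {E : measurableType q'} {n : nat} (X : 'I_n -> {RV P >-> E}).

Definition mutually_independent : Prop :=
  forall (J : {set 'I_n}) (S : 'I_n -> set E), (forall j, measurable (S j)) ->
  P (\bigcap_(j in [set` J]) X j @^-1` S j) =
  (\prod_(j in J) P (X j @^-1` S j))%E.

Definition identically_distributed : Prop :=
  forall (j k : 'I_n) (S : set E), measurable S ->
  distribution P (X j) S = distribution P (X k) S.

Definition random_sample_in (V : set E) : Prop :=
  [/\ mutually_independent, identically_distributed &
      forall j w, V (X j w)].

End RandomSample.

(* Main.v *)
(* The quadratic weight is, up to normalization, the density of a centered
   Gaussian vector with covariance [Omega], so that integrating [cos (tr (t' z))]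
   against it yields [exp (- 1/2 vec(z)' Omega vec(z))].  For the first formula,
   [|phi_n(t)|^2] is the average of [cos (tr (t' (X_j - X_k)))].  For the second,
   Fubini moves the weight integral inside the integral over [P_0], and the
   resulting Gaussian factor in [x - X_j] is absorbed by the Fisher-Bingham kernel
   by completing the square.  The Gaussian transform is obtained by induction on
   the dimension: the first coordinate is integrated out, which replaces the
   precision matrix by its Schur complement; in dimension one the transform solves
   a linear ODE in the frequency. *)

From HB Require Import structures.
Require Import Defs.
From mathcomp Require Import all_boot all_order all_algebra.
From mathcomp Require Import ring lra.
From mathcomp Require Import complex.
From mathcomp Require Import all_classical all_reals all_analysis measurable_realfun.

Import Order.TTheory GRing.Theory Num.Theory.
Import numFieldNormedType.Exports.

Local Open Scope classical_set_scope.
Local Open Scope ring_scope.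

(** * The Gaussian transform on the line *)

Section GaussianLine.
Context {R : realType}.
Implicit Types (k m t x th : R).
Local Notation mu := (@lebesgue_measure R).

(** Unnormalized normal density, parametrized by its precision [k]: in the induction on the
    dimension, [k] is the corner entry of a precision matrix and the center [m] depends on the
    remaining coordinates. *)
Definition gaussian k m x : R := expR (- 2^-1 * (k * (x - m) ^+ 2)).

Arguments gaussian : simpl never.

Lemma gaussian_ge0 k m x : 0 <= gaussian k m x.
Proof. exact: expR_ge0. Qed.

Lemma measurable_gaussian k m : measurable_fun setT (gaussian k m).
Proof.
apply: measurableT_comp => //; apply: measurable_funM => //.
apply: measurable_funM => //; apply: measurable_funX.
exact: measurable_funB.
Qed.

Lemma gaussianE k m x : 0 < k -> gaussian k m x = normal_fun m (Num.sqrt k^-1) x.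
Proof.
move=> k0; rewrite /gaussian /normal_fun sqr_sqrtr ?invr_ge0 ?ltW//.
congr expR; have := gt_eqF k0 => /negbT k0'.
by field.
Qed.

Lemma integral_gaussian k m : 0 < k ->
  (\int[mu]_x (gaussian k m x)%:E)%E = (Num.sqrt (2 * pi / k))%:E.
Proof.
move=> k0; have s0 : Num.sqrt k^-1 != 0 by rewrite gt_eqF// sqrtr_gt0 invr_gt0.
have p0 : normal_peak (Num.sqrt k^-1) != 0 by rewrite gt_eqF// normal_peak_gt0.
transitivity (\int[mu]_x ((Num.sqrt (2 * pi / k))%:E *
    (normal_pdf m (Num.sqrt k^-1) x)%:E))%E.
  apply: eq_integral => x _; rewrite -EFinM normal_pdfE//= gaussianE//.
  rewrite mulrA (_ : _ * normal_peak _ = 1) ?mul1r//.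
  rewrite /normal_peak sqr_sqrtr ?invr_ge0 ?(ltW k0)//.
  rewrite (_ : k^-1 * pi *+ 2 = 2 * pi / k); last by rewrite mulr2n; field; lra.
  by rewrite divff// gt_eqF// sqrtr_gt0 divr_gt0// mulr_gt0// pi_gt0.
rewrite integralZl//; last exact: integrable_normal_pdf.
by rewrite integral_normal_pdf mule1.
Qed.

Lemma integrable_gaussian k m : 0 < k ->
  mu.-integrable setT (EFin \o gaussian k m).
Proof.
move=> k0; apply/integrableP; split.
  by apply/measurable_EFinP; exact: measurable_gaussian.
under eq_integral do rewrite /= ger0_norm ?gaussian_ge0//.
by rewrite integral_gaussian// ltry.
Qed.

(** Half of the exponent pays for the linear factor: [gaussian k m] is the square of
    [gaussian (k / 2) m], and [|x - m|] times one of these two factors stays below [1 + 4 / k]. *)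
Lemma integrable_moment1_gaussian k m : 0 < k ->
  mu.-integrable setT (fun x => (`|x - m| * gaussian k m x)%:E).
Proof.
move=> k0.
have k20 : 0 < k / 2 by rewrite divr_gt0.
have ig : mu.-integrable setT
    (fun x => ((1 + 4 / k)%:E * (gaussian (k / 2) m x)%:E)%E).
  by apply: integrableZl => //; exact: integrable_gaussian.
apply: (le_integrable _ _ _ ig) => //.
- apply/measurable_EFinP; apply: measurable_funM.
    by apply: measurableT_comp => //; exact: measurable_funB.
  exact: measurable_gaussian.
- move=> x _ /=; rewrite lee_fin !normrM normr_id.
  rewrite !(ger0_norm (gaussian_ge0 _ _ _)) (ger0_norm (_ : 0 <= 1 + 4 / k)); last first.
    by rewrite addr_ge0// divr_ge0// ltW.
  have -> : gaussian k m x = gaussian (k / 2) m x * gaussian (k / 2) m x.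
    by rewrite -expRD; congr expR; field.
  rewrite mulrA ler_wpM2r ?gaussian_ge0//.
  have yge : 0 <= k / 4 * `|x - m| ^+ 2 by rewrite mulr_ge0// ?sqr_ge0//; lra.
  (* Expanding the product [(1 + 4 / k) * (1 + k / 4 * y ^+ 2)] leaves the summands [1] and
     [y ^+ 2], whose sum dominates [y]. Its second factor lies below [expR (k / 4 * y ^+ 2)] and is
     absorbed by half of the Gaussian. *)
  apply: (@le_trans _ _ ((1 + 4 / k) * (1 + k / 4 * `|x - m| ^+ 2) *
      gaussian (k / 2) m x)).
    rewrite ler_wpM2r ?gaussian_ge0//.
    set y := `|x - m|; have -> : (1 + 4 / k) * (1 + k / 4 * y ^+ 2) =
      1 + 4 / k + k / 4 * y ^+ 2 + y ^+ 2 by field; lra.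
    have : 0 <= 4 / k by rewrite divr_ge0// ltW.
    have := sqr_ge0 (y - 2^-1); rewrite -/y in yge; nra.
  rewrite -mulrA ler_piMr//; first by rewrite addr_ge0// divr_ge0// ltW.
  rewrite /gaussian -[X in _ * expR X]opprK expRN ler_pdivrMr ?expR_gt0// mul1r.
  apply: le_trans (expR_ge1Dx _).
  by rewrite real_normK ?num_real// lerD2l le_eqVlt; apply/orP; left; apply/eqP; field.
Qed.

Lemma cvg_gaussian k m : 0 < k -> gaussian k m x @[x --> +oo] --> 0.
Proof.
move=> k0; apply: (@squeeze_cvgr _ _ _ _ (cst 0)
    (fun x => expR (m + (2 * k)^-1) * expR (- x))).
- apply: nearW => x; rewrite gaussian_ge0/= -expRD ler_expR.
  (* The concave quadratic exponent lies below its tangent line of slope [-1], which touches it at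
     [m + k^-1] and has intercept [m + (2 * k)^-1]. *)
  have -> : m + (2 * k)^-1 - x = - 2^-1 * (k * (x - m) ^+ 2) +
      k / 2 * (x - m - k^-1) ^+ 2 by field; lra.
  by rewrite lerDl mulr_ge0 ?sqr_ge0//; lra.
- exact: cvg_cst.
- by rewrite -[X in _ --> X](mulr0 (expR (m + (2 * k)^-1)));
    apply: cvgM; [exact: cvg_cst|exact: cvgr_expR].
Qed.

Lemma gaussianN k m x : gaussian k m (- x) = gaussian k (- m) x.
Proof. by congr expR; ring. Qed.

Lemma is_derive_gaussian k m x :
  is_derive x 1 (gaussian k m) (- (k * (x - m)) * gaussian k m x).
Proof.
have ? : is_derive x 1 (fun y : R => - 2^-1 * (k * (y - m) ^+ 2)) (- (k * (x - m))).
  by apply: is_derive_eq; rewrite /GRing.scale /=; field.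
rewrite mulrC.
exact: (@is_derive1_comp R expR (fun y : R => - 2^-1 * (k * (y - m) ^+ 2))).
Qed.

(** By dominated convergence the integral is the limit of the integrals over growing symmetric
    intervals. The fundamental theorem of calculus turns these into differences of values of [h] at
    the endpoints, which tend to 0. *)
Lemma integral_derive_eq0 (h h' : R -> R) :
  (forall x, is_derive x 1 h (h' x)) -> continuous h' ->
  mu.-integrable setT (EFin \o h') ->
  h x @[x --> +oo] --> 0 -> h (- x) @[x --> +oo] --> 0 ->
  (\int[mu]_x (h' x)%:E = 0)%E.
Proof.
move=> dh ch' ih' hy hNy.
(* The radius is [n.+1] and not [n], since the fundamental theorem is applied on intervals with
   distinct endpoints. *)
pose I (n : nat) : set R := `[- n.+1%:R, n.+1%:R]%classic.
pose f_ n x := ((h' \_ (I n)) x)%:E.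
have [] := @dominated_convergence _ _ _ mu setT measurableT f_ (EFin \o h')
  (fun x => `|(h' x)%:E|%E).
- move=> n; apply/measurable_EFinP.
  have mI : measurable (I n) by exact: measurable_itv.
  by apply: (measurable_restrictT h' mI).1; apply: measurable_funTS;
    exact: continuous_measurable_fun.
- by apply/measurable_EFinP; exact: continuous_measurable_fun.
- apply: aeW => x _; apply: cvg_near_cst.
  near=> n; rewrite /f_ patchT// inE /I/= in_itv/= -ler_norml.
  apply/ltW/(lt_le_trans (_ : `|x| < (Num.truncn `|x|).+1%:R)); first exact: truncnS_gt.
  rewrite ler_nat ltnS; near: n; exact: nbhs_infty_ge.
- exact: integrable_abse ih'.
- apply: aeW => x n _; rewrite /f_ patchE; case: ifPn => // _.
  by have := abse_ge0 (h' x)%:E; rewrite -[X in (X <= _)%E]abse0.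
move=> _ _ cvgI.
have cvg0 : (\int[mu]_x f_ n x)%E @[n --> \oo] --> 0%E.
  rewrite (_ : (fun n => _) = (fun n => (h n.+1%:R - h (- n.+1%:R))%:E)); last first.
    apply/funext => n.
    transitivity (\int[mu]_(x in I n) (h' x)%:E)%E.
      rewrite [RHS]integral_mkcond; apply: eq_integral => x _.
      by rewrite /f_ !patchE; case: ifP.
    rewrite (continuous_FTC2 (F := h)) //.
    - by rewrite -subr_gt0 opprK addr_gt0.
    - exact: continuous_subspaceT.
    - split.
      + by move=> x _; have [] := dh x.
      + apply: cvg_at_right_filter.
        by apply/differentiable_continuous/derivable1_diffP; have [] := dh (- n.+1%:R).
      + apply: cvg_at_left_filter.
        by apply/differentiable_continuous/derivable1_diffP; have [] := dh (n.+1%:R).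
    - by move=> x _; rewrite derive1E; have [] := dh x.
  apply: cvg_EFin; first exact: nearW.
  have hN : h (n%:R : R) @[n --> \oo] --> 0.
    exact: (cvg_comp _ _ cvgr_idn hy).
  have hNN : h (- (n%:R : R)) @[n --> \oo] --> 0.
    exact: (cvg_comp _ _ cvgr_idn hNy).
  rewrite -[X in _ --> X](subr0 0); apply: cvgB.
    by rewrite (cvg_shiftS (fun n => h n%:R)).
  by rewrite (cvg_shiftS (fun n => h (- n%:R))).
exact: (cvg_unique _ cvgI cvg0).
Unshelve. all: end_near. Qed.


Lemma measurable_gaussian_wave k m (f : R -> R) a b :
  measurable_fun setT f ->
  measurable_fun setT (fun x => f (a * (x - m) + b) * gaussian k m x).
Proof.
move=> mf; apply: measurable_funM; last exact: measurable_gaussian.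
apply: measurableT_comp => //; apply: measurable_funD => //.
by apply: measurable_funM => //; exact: measurable_funB.
Qed.

Lemma integrable_gaussian_wave k m (f : R -> R) a b : 0 < k ->
  measurable_fun setT f -> (forall x, `|f x| <= 1) ->
  mu.-integrable setT (fun x => (f (a * (x - m) + b) * gaussian k m x)%:E).
Proof.
move=> k0 mf f1; apply: (le_integrable _ _ _ (integrable_gaussian k m k0)) => //.
  by apply/measurable_EFinP; exact: measurable_gaussian_wave.
by move=> x _; rewrite lee_fin normrM ler_piMl.
Qed.

Lemma integrable_moment1_gaussian_wave k m (f : R -> R) a b : 0 < k ->
  measurable_fun setT f -> (forall x, `|f x| <= 1) ->
  mu.-integrable setT
    (fun x => ((x - m) * (f (a * (x - m) + b) * gaussian k m x))%:E).
Proof.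
move=> k0 mf f1; apply: (le_integrable _ _ _ (integrable_moment1_gaussian k m k0)) => //.
  apply/measurable_EFinP; apply: measurable_funM; first exact: measurable_funB.
  exact: measurable_gaussian_wave.
move=> x _; rewrite lee_fin !normrM normr_id ler_wpM2l//.
by rewrite ler_piMl.
Qed.

Lemma derive_gaussian_wave k m t th x :
  is_derive x 1 (fun y => sin (k * t * (y - m) + th) * gaussian k m y)
    (k * t * (cos (k * t * (x - m) + th) * gaussian k m x) -
     k * ((x - m) * (sin (k * t * (x - m) + th) * gaussian k m x))).
Proof.
have ? := is_derive_gaussian k m x.
have ? : is_derive x 1 (fun y : R => k * t * (y - m) + th) (k * t).
  by apply: is_derive_eq; rewrite /GRing.scale /=; ring.
have ? : is_derive x 1 (fun y : R => sin (k * t * (y - m) + th))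
    (cos (k * t * (x - m) + th) * (k * t)).
  exact: (@is_derive1_comp R sin (fun y : R => k * t * (y - m) + th)).
by apply: is_derive_eq; rewrite /GRing.scale /=; ring.
Qed.

(** The sine wave times the Gaussian vanishes at both ends of the line, so its derivative integrates
    to 0. With the frequency written as [k * t], both terms of that derivative carry the factor [k],
    which cancels. *)
Lemma gaussian_by_parts k m t th : 0 < k ->
  \int[mu]_x ((x - m) * (sin (k * t * (x - m) + th) * gaussian k m x)) =
  t * \int[mu]_x (cos (k * t * (x - m) + th) * gaussian k m x).
Proof.
move=> k0.
have ic := @integrable_gaussian_wave k m cos (k * t) th k0
  (continuous_measurable_fun (@continuous_cos R)) (@cos_max R).
have isin := @integrable_moment1_gaussian_wave k m sin (k * t) th k0
  (continuous_measurable_fun (@continuous_sin R)) (@sin_max R).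
have ikc := integrableZl measurableT (k * t) ic.
have iks := integrableZl measurableT k isin.
have ce y : {for y, continuous (fun x => k * t * (x - m) + th)}.
  have ? : is_derive y 1 (fun x : R => k * t * (x - m) + th) (k * t).
    by apply: is_derive_eq; rewrite /GRing.scale /=; ring.
  by apply/differentiable_continuous/derivable1_diffP.
have cg y : {for y, continuous (gaussian k m)}.
  have ? := is_derive_gaussian k m y.
  by apply/differentiable_continuous/derivable1_diffP.
have int0 := @integral_derive_eq0 _ _ (derive_gaussian_wave k m t th).
have : k * t * \int[mu]_x (cos (k * t * (x - m) + th) * gaussian k m x) -
    k * \int[mu]_x ((x - m) * (sin (k * t * (x - m) + th) * gaussian k m x)) = 0.
  rewrite -RintegralZl// -RintegralZl// -RintegralB//.
  rewrite /Rintegral int0//.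
  - move=> y; apply: cvgB; apply: cvgM; try exact: cvg_cst; apply: cvgM => //.
    + by apply: continuous_comp => //; exact: continuous_cos.
    + exact: cg.
    + by apply: cvgB; [exact: cvg_id|exact: cvg_cst].
    + apply: cvgM => //; last exact: cg.
      by apply: continuous_comp => //; exact: continuous_sin.
  - exact: (integrableB measurableT ikc iks).
  - apply: (@squeeze_cvgr _ _ _ _ (fun x => - gaussian k m x) (gaussian k m)).
    + apply: nearW => x; rewrite -ler_norml normrM.
      by rewrite (ger0_norm (gaussian_ge0 _ _ _)) ler_piMl ?sin_max ?gaussian_ge0.
    + by rewrite -oppr0; apply: cvgN; exact: cvg_gaussian.
    + exact: cvg_gaussian.
  (* Reflection reduces the limit at minus infinity to the limit at plus infinity of the Gaussian
     centered at [- m]. *)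
  - apply: (@squeeze_cvgr _ _ _ _ (fun x => - gaussian k (- m) x) (gaussian k (- m))).
    + apply: nearW => x; rewrite -ler_norml normrM gaussianN.
      by rewrite (ger0_norm (gaussian_ge0 _ _ _)) ler_piMl ?sin_max ?gaussian_ge0.
    + by rewrite -oppr0; apply: cvgN; exact: cvg_gaussian.
    + exact: cvg_gaussian.
by move=> /eqP; rewrite subr_eq0 -mulrA => /eqP/(mulfI (negbT (gt_eqF k0))) ->.
Qed.



End GaussianLine.

(** * The cosine transform of a Gaussian as a function of the frequency *)

Section GaussianCos.
Context {R : realType}.
Implicit Types (k m t x th : R).
Local Notation mu := (@lebesgue_measure R).

(** Differentiation under the integral sign produces a first moment against a sine, and
    [gaussian_by_parts] turns this moment back into a multiple of the original integral. *)
Lemma is_derive_integral_gaussian_cos k m th t : 0 < k ->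
  is_derive t 1
    (fun s => \int[mu]_x (cos (k * s * (x - m) + th) * gaussian k m x))
    (- (k * t) * \int[mu]_x (cos (k * t * (x - m) + th) * gaussian k m x)).
Proof.
move=> k0.
pose f s x := cos (k * s * (x - m) + th) * gaussian k m x.
have df (s x : R) : is_derive s 1 (f ^~ x)
    (- k * ((x - m) * (sin (k * s * (x - m) + th) * gaussian k m x))).
  have ? : is_derive s 1 (fun s : R => k * s * (x - m) + th) (k * (x - m)).
    by apply: is_derive_eq; rewrite /GRing.scale /=; ring.
  have ? : is_derive s 1 (fun s : R => cos (k * s * (x - m) + th))
      (- sin (k * s * (x - m) + th) * (k * (x - m))).
    exact: (@is_derive1_comp R cos (fun s : R => k * s * (x - m) + th)).
  by apply: is_derive_eq; rewrite /GRing.scale /=; ring.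
have d1f (s x : R) : partial1of2 f s x =
    - k * ((x - m) * (sin (k * s * (x - m) + th) * gaussian k m x)).
  by rewrite partial1of2E; have [] := df s x.
have isin := @integrable_moment1_gaussian_wave R k m sin (k * t) th k0
  (continuous_measurable_fun (@continuous_sin R)) (@sin_max R).
(* The dominating function [k * (|x - m| * gaussian k m x)] does not depend on the frequency, so any
   neighbourhood of [t] serves; radius 1 is an arbitrary choice. *)
have tI : `]t - 1, t + 1[%classic t by rewrite /= in_itv/= ltrBlDr ltrDl ltr01.
have := @cvg_differentiation_under_integral R _ _ mu f setT measurableT t
  (t - 1) (t + 1) tI _ _ (fun x => k * (`|x - m| * gaussian k m x)) _ _ _.
move=> cvgF.
have {}cvgF : h^-1 *: (\int[mu]_x f (h + t) x - \int[mu]_x f t x) @[h --> 0^'] -->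
    - (k * t) * \int[mu]_x f t x.
  rewrite mulNr -mulrA -gaussian_by_parts// -mulNr -RintegralZl//.
  have <- : \int[mu]_x partial1of2 f t x = \int[mu]_x (- k *
      ((x - m) * (sin (k * t * (x - m) + th) * gaussian k m x))).
    by apply: eq_Rintegral => x _; rewrite d1f.
  apply: cvgF.
  - move=> s _.
    exact: (@integrable_gaussian_wave R k m cos (k * s) th k0
      (continuous_measurable_fun (@continuous_cos R)) (@cos_max R)).
  - by move=> s x _ _; have [] := df s x.
  - by move=> x; rewrite mulr_ge0 ?(ltW k0)// mulr_ge0// gaussian_ge0.
  - exact: (integrableZl measurableT _ (integrable_moment1_gaussian k m k0)).
  - move=> s x _ _; rewrite d1f mulNr normrN !normrM (ger0_norm (ltW k0)).
    rewrite ler_pM2l// ler_wpM2l// (ger0_norm (gaussian_ge0 _ _ _)).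
    by rewrite ler_piMl ?sin_max ?gaussian_ge0.
split.
  by apply/cvg_ex; eexists; under eq_fun do rewrite scaler1; exact: cvgF.
by rewrite -derive1E; apply/cvg_lim => //; exact: cvgF.
Qed.

(* As a function of [t], the integral solves the linear ODE [F' = - k t F]. *)
Lemma integral_gaussian_cos k m t th : 0 < k ->
  \int[mu]_x (cos (k * t * (x - m) + th) * gaussian k m x) =
  Num.sqrt (2 * pi / k) * expR (- 2^-1 * (k * t ^+ 2)) * cos th.
Proof.
move=> k0.
pose F s := \int[mu]_x (cos (k * s * (x - m) + th) * gaussian k m x).
have F0 : F 0 = Num.sqrt (2 * pi / k) * cos th.
  rewrite /F; under eq_Rintegral do rewrite mulr0 mul0r add0r.
  rewrite RintegralZl//; last exact: integrable_gaussian.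
  by rewrite /Rintegral integral_gaussian// mulrC.
(* The exponential is the integrating factor of the equation: the product has derivative 0, hence
   keeps its value at frequency 0. *)
have : expR (2^-1 * (k * t ^+ 2)) * F t = F 0.
  have -> : F 0 = expR (2^-1 * (k * 0 ^+ 2)) * F 0.
    by rewrite expr0n/= !mulr0 expR0 mul1r.
  apply: (@is_derive_0_is_cst _ (fun s => expR (2^-1 * (k * s ^+ 2)) * F s)) => s.
  have ? := is_derive_integral_gaussian_cos k m th s k0.
  have ? : is_derive s 1 (fun s : R => 2^-1 * (k * s ^+ 2)) (k * s).
    by apply: is_derive_eq; rewrite /GRing.scale /=; field.
  have ? : is_derive s 1 (fun s : R => expR (2^-1 * (k * s ^+ 2)))
      (expR (2^-1 * (k * s ^+ 2)) * (k * s)).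
    exact: (@is_derive1_comp R expR (fun s : R => 2^-1 * (k * s ^+ 2))).
  by apply: is_derive_eq; rewrite /GRing.scale /= -/(F s); ring.
by move=> eF; rewrite [RHS]mulrAC -F0 -eF mulrAC -expRD mulNr addrN expR0 mul1r.
Qed.

End GaussianCos.

(** * Schur complements of positive definite matrices *)

Section SchurComplement.
Context {R : realType}.

Definition bform {n} (K : 'M[R]_n) (y u : 'cV[R]_n) : R := (y^T *m K *m u) 0 0.

Lemma bformC n (K : 'M[R]_n) y u : K^T = K -> bform K y u = bform K u y.
Proof.
move=> Ks; rewrite /bform; transitivity ((y^T *m K *m u)^T 0 0).
  by rewrite [RHS]mxE.
by rewrite !trmx_mul trmxK Ks mulmxA.
Qed.

Lemma qformD n (K : 'M[R]_n) y u : K^T = K ->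
  qform K (y + u) = qform K y + 2 * bform K y u + qform K u.
Proof.
move=> Ks; rewrite /qform -!/(bform _ _ _).
have bD1 a b c : bform K (a + b) c = bform K a c + bform K b c.
  by rewrite /bform linearD/= !mulmxDl mxE.
have bD2 a b c : bform K a (b + c) = bform K a b + bform K a c.
  by rewrite /bform mulmxDr mxE.
by rewrite bD1 !bD2 [bform K u y]bformC//; ring.
Qed.

(** The upper right block is replaced by the transpose of the lower left one, which agrees with the
    usual Schur complement for symmetric [K]. *)
Definition schur {n} (K : 'M[R]_(1 + n)) : 'M[R]_n :=
  drsubmx K - (K 0 0)^-1 *: (dlsubmx K *m (dlsubmx K)^T).

(** Under a centered Gaussian with precision matrix [K], this is minus the conditional mean of the
    first coordinate given that the others equal [v]. *)
Definition schur_shift {n} (K : 'M[R]_(1 + n)) (v : 'cV[R]_n) : R :=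
  (K 0 0)^-1 * ((dlsubmx K)^T *m v) 0 0.

Variables (n : nat) (K : 'M[R]_(1 + n)).
Hypothesis Ks : K^T = K.

Lemma schur_sym : (schur K)^T = schur K.
Proof.
rewrite /schur linearB/= linearZ/= trmx_mul trmxK; congr (_ - _).
by rewrite trmx_drsub Ks.
Qed.

Let KE : K = block_mx (K 0 0)%:M (dlsubmx K)^T (dlsubmx K) (drsubmx K).
Proof.
rewrite -[LHS]submxK; congr block_mx; last by rewrite trmx_dlsub Ks.
rewrite [LHS]mx11_scalar; congr (_%:M); rewrite !mxE; congr (K _ _); exact: val_inj.
Qed.

(** Completes the square in the first coordinate. The polarized form is used twice: with equal
    arguments for the Gaussian exponent, and with distinct ones for the phase of the cosine. *)
Lemma bform_schur y0 y1 x v : K 0 0 != 0 ->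
  bform K (col_mx y0%:M y1) (col_mx x%:M v) =
  K 0 0 * (y0 + schur_shift K y1) * (x + schur_shift K v) + bform (schur K) y1 v.
Proof.
have mul11 (A B : 'M[R]_1) : (A *m B) 0 0 = A 0 0 * B 0 0.
  by rewrite mxE big_ord1.
move=> k0; rewrite /bform {1}KE tr_col_mx mul_row_block mul_row_col.
rewrite /schur /schur_shift; set k := K 0 0 in k0 *.
set b := dlsubmx K; set C := drsubmx K.
have yb : y1^T *m b = b^T *m y1.
  by rewrite -[LHS]trmxK trmx_mul trmxK [b^T *m y1]mx11_scalar tr_scalar_mx.
rewrite tr_scalar_mx mulmxBr mulmxBl -scalemxAr -scalemxAl !mulmxDl mulmxA yb.
rewrite -[y0%:M *m b^T *m v]mulmxA -[b^T *m y1 *m b^T *m v]mulmxA.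
rewrite !(mul11, mxE).
by rewrite eqxx !mulr1n; field.
Qed.

(** One step of block elimination: [K] factors as a unipotent lower triangular matrix times a block
    upper triangular one with diagonal blocks [K 0 0] and [schur K]. *)
Lemma det_schur : K 0 0 != 0 -> \det K = K 0 0 * \det (schur K).
Proof.
move=> k0.
have {1}-> : K = block_mx 1%:M 0 ((K 0 0)^-1 *: dlsubmx K) 1%:M *m
    block_mx (K 0 0)%:M (dlsubmx K)^T 0 (schur K).
  rewrite mulmx_block !mul1mx !mul0mx !addr0 mul_mx_scalar scalerA.
  by rewrite divff// scale1r -scalemxAl /schur addrC subrK -KE.
by rewrite det_mulmx det_lblock det_ublock !det1 !mul1r det_scalar1.
Qed.

Hypothesis Kp : posdefmx K.

Lemma posdef_diag_gt0 : 0 < K 0 0.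
Proof.
have e0 : col_mx 1%:M 0 != 0 :> 'cV[R]_(1 + n).
  apply/eqP => /(congr1 (fun u : 'cV[R]_(1 + n) => usubmx u 0 0)).
  by rewrite col_mxKu !mxE => /eqP; rewrite oner_eq0.
have := Kp _ e0; rewrite /qform {1}KE tr_col_mx mul_row_block mul_row_col.
by rewrite trmx0 !mul0mx !addr0 !mulmx0 addr0 tr_scalar_mx mul1mx mulmx1 mxE eqxx.
Qed.

Lemma schur_posdef : posdefmx (schur K).
Proof.
move=> v v0; have k0 := posdef_diag_gt0.
(* This first coordinate makes the completed square vanish, so that only the Schur complement
   remains in the form. *)
have u0 : col_mx (- schur_shift K v)%:M v != 0 :> 'cV[R]_(1 + n).
  by apply: contra_neq v0 => /(congr1 dsubmx); rewrite col_mxKd linear0.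
have := Kp _ u0; rewrite /qform -!/(bform _ _ _) bform_schur ?gt_eqF//.
by rewrite addNr !mulr0 add0r.
Qed.

End SchurComplement.

(** By elimination the determinant is a product of pivots, each being the corner entry of a positive
    definite matrix. *)
Lemma posdef_det_gt0 {R : realType} n (K : 'M[R]_n) :
  K^T = K -> posdefmx K -> 0 < \det K.
Proof.
elim: n K => [|n IHn] K Ks Kp; first by rewrite det_mx00.
rewrite (det_schur _ K Ks) ?gt_eqF ?(posdef_diag_gt0 _ K Ks)//.
by rewrite mulr_gt0 ?(posdef_diag_gt0 _ K Ks)// IHn ?schur_sym//; exact: schur_posdef.
Qed.

Section PosdefInverse.
Context {R : realType} {n : nat} (K : 'M[R]_n).
Hypotheses (Ks : K^T = K) (Kp : posdefmx K).

Lemma posdef_unitmx : K \in unitmx.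
Proof. by rewrite unitmxE unitfE gt_eqF// posdef_det_gt0. Qed.

(** For an argument of the form [K *m y] the inverse cancels. This turns a pairing with a frequency
    vector into a form in the precision matrix, as [integral_mgaussian_cos] requires. *)
Lemma bform_invmx (y u : 'cV[R]_n) : bform (invmx K) (K *m y) u = (y^T *m u) 0 0.
Proof.
by rewrite /bform trmx_mul Ks mulmxK ?posdef_unitmx.
Qed.

Lemma qform_invmx (y : 'cV[R]_n) : qform (invmx K) (K *m y) = qform K y.
Proof. by rewrite /qform -/(bform _ _ _) bform_invmx mulmxA. Qed.

Lemma invmx_sym : (invmx K)^T = invmx K.
Proof. by rewrite trmx_inv Ks. Qed.

Lemma posdef_invmx : posdefmx (invmx K).
Proof.
move=> u u0; rewrite -(mulKVmx posdef_unitmx u) qform_invmx; apply: Kp.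
by apply: contra_neq u0 => v0; rewrite -(mulKVmx posdef_unitmx u) v0 mulmx0.
Qed.

End PosdefInverse.

(** * The Gaussian transform on tuples *)

Section LebesgueTuple.
Context {R : realType}.
Local Notation mu := (@lebesgue_measure R).
Local Notation tup n := (n.-tuple (measurableTypeR R)).

Definition cube n (c : nat) : set (tup n) :=
  \bigcap_(i in [set: 'I_n]) (fun s => tnth s i) @^-1` `[- c%:R, c%:R].

Lemma measurable_cube n c : measurable (cube n c).
Proof.
apply: fin_bigcap_measurable; first exact: finite_finset.
move=> i _; rewrite -[X in measurable X]setTI.
by apply: measurable_tnth => //; exact: measurable_itv.
Qed.

Lemma lebesgue_tuple_cube_lty n c : (@lebesgue_tuple R n (cube n c) < +oo)%E.
Proof.
elim: n => [|n IHn] /=; first by rewrite diracE; case: (_ \in _); rewrite ltry.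
rewrite /pushforward.
have -> : (fun x : tup n * measurableTypeR R =>
      [the n.+1.-tuple _ of x.2 :: x.1]) @^-1` cube n.+1 c =
    cube n c `*` `[- c%:R, c%:R]%classic.
  apply/seteqP; split => [[s x] /= h|[s x] /= [h hx] i _ /=].
    split; first by move=> i _; have := h (lift ord0 i) I; rewrite /= tnthS.
    exact: (h ord0 I).
  by case: (unliftP ord0 i) => [j ->|->] //=; rewrite tnthS; exact: h.
have muc : (mu `[(- c%:R)%R, c%:R%R]%classic < +oo)%E.
  by rewrite lebesgue_measure_itv /=; case: ifP => _; rewrite ltry.
rewrite product_measure1E//; last exact: measurable_cube.
apply: lte_mul_pinfty => //; first by rewrite ge0_fin_numE.
Qed.

Lemma sigma_finite_lebesgue_tuple n : sigma_finite setT (@lebesgue_tuple R n).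
Proof.
exists (cube n); last by move=> c; split; [exact: measurable_cube|
  exact: lebesgue_tuple_cube_lty].
apply/esym/seteqP; split => // s _.
(* A sum of nonnegative bounds dominates each of them, so this single side length works for all
   coordinates. *)
pose M := \sum_(i < n) (Num.truncn `|tnth s i : R|).+1.
exists M => // i _; rewrite /= in_itv/= -ler_norml.
apply: (le_trans (ltW (truncnS_gt _))); rewrite ler_nat.
by rewrite /M (bigD1 i)//= leq_addr.
Qed.

(* [lebesgue_tuple] being a fixpoint, it cannot carry a canonical sigma-finite
   structure: this named copy does. *)
Definition lebesgue_tuple_fun n : set (tup n) -> \bar R := @lebesgue_tuple R n.

HB.instance Definition _ n := Measure.copy (@lebesgue_tuple_fun n) (@lebesgue_tuple R n).

HB.instance Definition _ n := Measure_isSigmaFinite.Build _ _ _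
  (@lebesgue_tuple_fun n) (sigma_finite_lebesgue_tuple n).

End LebesgueTuple.

Section GaussianTuple.
Context {R : realType}.
Local Notation mu := (@lebesgue_measure R).
Local Notation tup n := (n.-tuple (measurableTypeR R)).
Local Notation lam n := (@lebesgue_tuple_fun R n).

Lemma measurable_bform {d} {T : measurableType d} n (K : 'M[R]_n)
    (U V : T -> 'cV[R]_n) :
  (forall i, measurable_fun setT (fun x => U x i 0)) ->
  (forall i, measurable_fun setT (fun x => V x i 0)) ->
  measurable_fun setT (fun x => bform K (U x) (V x)).
Proof.
move=> mU mV.
have -> : (fun x => bform K (U x) (V x)) =
    (fun x => \sum_j (\sum_i U x i 0 * K i j) * V x j 0).
  apply/funext => x; rewrite /bform mxE; apply: eq_bigr => j _.
  by rewrite mxE; congr (_ * _); apply: eq_bigr => i _; rewrite mxE.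
apply: measurable_sum => j; apply: measurable_funM => //.
by apply: measurable_sum => i; apply: measurable_funM.
Qed.

Definition col_tuple {n} (s : tup n) : 'cV[R]_n := \col_i tnth s i.

Lemma measurable_col_tuple n (i : 'I_n) :
  measurable_fun setT (fun s : tup n => col_tuple s i 0 : R).
Proof. by under eq_fun do rewrite mxE; exact: measurable_tnth. Qed.

Lemma col_tuple_cons n (s : tup n) (x : measurableTypeR R) :
  col_tuple [the n.+1.-tuple _ of x :: s] =
  col_mx (x : R)%:M (col_tuple s) :> 'cV[R]_(1 + n).
Proof.
apply/matrixP => i j; rewrite !mxE; case: splitP => [l il|l il].
  rewrite !mxE [l]ord1 (ord1 j) eqxx mulr1n.
  by rewrite (_ : i = ord0)//; apply: val_inj; rewrite /= il [l]ord1.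
by rewrite mxE (_ : i = lift ord0 l) ?tnthS//; exact: val_inj.
Qed.

(** The measure on [n.+1]-tuples is by construction the image of a product measure, so a change of
    variables followed by Fubini applies. The head of the tuple becomes the inner variable, ready to
    be integrated out first. *)
Lemma integral_lebesgue_tupleS n (f : tup n.+1 -> R) :
  measurable_fun setT f ->
  (lam n \x mu)%E.-integrable setT
    (fun z => (f [the n.+1.-tuple _ of z.2 :: z.1])%:E) ->
  (lam n.+1).-integrable setT (EFin \o f) /\
  (\int[lam n.+1]_s (f s)%:E =
   \int[lam n]_s \int[mu]_x (f [the n.+1.-tuple _ of x :: s])%:E)%E.
Proof.
move=> mf intf; have mEf : measurable_fun setT (EFin \o f) by exact/measurable_EFinP.
split.
  exact: (@integrable_pushforward _ _ _ _ _ _ (@measurable_cons_prod R n)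
    (lam n \x mu)%E setT (EFin \o f) mEf intf measurableT).
rewrite (integral12_prod_meas1 intf).
exact: (@integral_pushforward _ _ _ _ _ _ (@measurable_cons_prod R n)
  (lam n \x mu)%E setT (EFin \o f) mEf intf measurableT).
Qed.

End GaussianTuple.

Section GaussianTupleIntegral.
Context {R : realType}.
Local Notation mu := (@lebesgue_measure R).
Local Notation tup n := (n.-tuple (measurableTypeR R)).
Local Notation lam n := (@lebesgue_tuple_fun R n).

Definition mgaussian {n} (K : 'M[R]_n) (u : 'cV[R]_n) : R :=
  expR (- 2^-1 * qform K u).

(** For [K] symmetric positive definite, this is the integral of [mgaussian K] over the whole
    space. *)
Definition mgaussian_mass {n} (K : 'M[R]_n) : R :=
  Num.sqrt ((2 * pi) ^+ n / \det K).

Lemma mgaussian_ge0 n (K : 'M[R]_n) u : 0 <= mgaussian K u.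
Proof. exact: expR_ge0. Qed.

Lemma measurable_mgaussian n (K : 'M[R]_n) :
  measurable_fun setT (fun s : tup n => mgaussian K (col_tuple s)).
Proof.
apply: (@measurableT_comp _ _ _ _ _ _ (@expR R)) => //.
apply: measurable_funM => //; rewrite /qform.
by apply: (measurable_bform n K) => i; exact: measurable_col_tuple.
Qed.

Lemma measurable_mgaussian_cos n (K L : 'M[R]_n) y th :
  measurable_fun setT (fun s : tup n =>
    cos (bform L y (col_tuple s) + th) * mgaussian K (col_tuple s)).
Proof.
apply: measurable_funM; last exact: measurable_mgaussian.
apply: (measurableT_comp (continuous_measurable_fun (@continuous_cos R))).
apply: measurable_funD => //; apply: measurable_bform => i //.
exact: measurable_col_tuple.
Qed.

Lemma mgaussian_cons n (K : 'M[R]_(1 + n)) (x : R) v : K^T = K -> K 0 0 != 0 ->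
  mgaussian K (col_mx x%:M v) =
  gaussian (K 0 0) (- schur_shift K v) x * mgaussian (schur K) v.
Proof.
move=> Ks k0; rewrite /mgaussian /qform -!/(bform _ _ _) bform_schur//.
by rewrite -expRD opprK; congr expR; ring.
Qed.

Lemma mgaussian_massS n (K : 'M[R]_(1 + n)) : K^T = K -> 0 < K 0 0 ->
  mgaussian_mass K = Num.sqrt (2 * pi / K 0 0) * mgaussian_mass (schur K).
Proof.
move=> Ks k0; rewrite /mgaussian_mass -sqrtrM; last first.
  by rewrite divr_ge0 ?(ltW k0)// mulr_ge0// pi_ge0.
by rewrite det_schur ?gt_eqF// invfM exprS; congr Num.sqrt; ring.
Qed.

Lemma integral_gaussian_cosE (k m t th c : R) : 0 < k ->
  (\int[mu]_x (cos (k * t * (x - m) + th) * (gaussian k m x * c))%:E =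
   (Num.sqrt (2 * pi / k) * expR (- 2^-1 * (k * t ^+ 2)) * cos th * c)%:E)%E.
Proof.
move=> k0.
have ig := @integrable_gaussian_wave R k m cos (k * t) th k0
  (continuous_measurable_fun (@continuous_cos R)) (@cos_max R).
under eq_integral do rewrite mulrA EFinM.
rewrite integralZr// -(integral_gaussian_cos k m t th k0) EFinM fineK//.
exact: integrable_fin_num.
Qed.

(* Integrating out the first coordinate replaces [K] by its Schur complement;
   writing the frequency as [K *m y] keeps the inverse of [K] out of sight. *)
Lemma integral_mgaussian_cos n (K : 'M[R]_n) : K^T = K -> posdefmx K ->
  (lam n).-integrable setT (fun s => (mgaussian K (col_tuple s))%:E) /\
  forall y th,
    (\int[lam n]_s (cos (bform K y (col_tuple s) + th) *
                    mgaussian K (col_tuple s))%:E =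
     (mgaussian_mass K * mgaussian K y * cos th)%:E)%E.
Proof.
elim: n K => [|n IHn] K Ks Kp.
  (* In dimension 0 the measure is the Dirac mass at the empty tuple, all forms vanish and the
     determinant is 1. *)
  have bK0 y u : bform K y u = 0 by rewrite /bform mxE big_ord0.
  have g1 u : mgaussian K u = 1.
    by rewrite /mgaussian /qform -/(bform _ _ _) bK0 mulr0 expR0.
  split.
    apply/integrableP; split.
      by apply/measurable_EFinP; exact: measurable_mgaussian.
    under eq_integral do rewrite g1.
    by rewrite [ltLHS]integral_dirac// diracT mul1e ltry.
  move=> y th; under eq_integral do rewrite bK0 add0r g1 mulr1.
  rewrite [LHS]integral_dirac// diracT mul1e g1 mulr1.
  by rewrite /mgaussian_mass expr0 det_mx00 divr1 sqrtr1 mul1r.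
have k0 := posdef_diag_gt0 _ _ Ks Kp.
have k0' : (K : 'M[R]_(1 + n)) 0 0 != 0 by rewrite gt_eqF.
have [IHi IHc] := IHn _ (schur_sym _ _ Ks) (schur_posdef _ _ Ks Kp).
pose G := fun s : tup n.+1 => mgaussian K (col_tuple s).
(* By Tonelli it suffices that the iterated integral is finite; the inner one is a constant times
   the Gaussian of the Schur complement, which is integrable by induction. *)
have iG : (lam n \x mu)%E.-integrable setT
    (fun z => (G [the n.+1.-tuple _ of z.2 :: z.1])%:E).
  apply/integrable12ltyP => /=.
    apply/measurable_EFinP; apply: (@measurableT_comp _ _ _ _ _ _ G) => //.
      exact: measurable_mgaussian.
    exact: measurable_cons_prod.
  rewrite (_ : (\int[_]_x _)%E = (\int[lam n]_s ((Num.sqrt (2 * pi / K 0 0))%:E *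
      (mgaussian (schur K) (col_tuple s))%:E))%E).
    by have /fin_numPlt/andP[] := integrable_fin_num measurableT
      (integrableZl measurableT (Num.sqrt (2 * pi / K 0 0)) IHi).
  apply: eq_integral => s _; rewrite -EFinM.
  (* At frequency 0 and phase 0 the cosine is 1, so the line transform gives the plain mass. *)
  have := integral_gaussian_cosE (K 0 0) (- schur_shift K (col_tuple s)) 0 0
    (mgaussian (schur K) (col_tuple s)) k0.
  rewrite expr0n/= !mulr0 expR0 cos0 !mulr1 => <-.
  apply: eq_integral => x _.
  have G0 := mgaussian_ge0 _ K (col_tuple [the n.+1.-tuple _ of x :: s]).
  rewrite /= (ger0_norm G0) /G col_tuple_cons mgaussian_cons//.
  by rewrite mul0r addr0 cos0 mul1r.
split.
  exact: (integral_lebesgue_tupleS n G (measurable_mgaussian _ K) iG).1.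
move=> y th.
have -> : y = col_mx (usubmx (y : 'cV[R]_(1 + n)) 0 0)%:M (dsubmx (y : 'cV[R]_(1 + n))).
  by rewrite -mx11_scalar vsubmxK.
set y0 := usubmx _ 0 0; set y1 := dsubmx _.
rewrite (integral_lebesgue_tupleS _ _ (measurable_mgaussian_cos _ _ _ _ _) _).2; last first.
  apply: (le_integrable _ _ _ iG) => //.
    apply/measurable_EFinP; apply: (measurableT_comp (measurable_mgaussian_cos _ K K _ th)).
    exact: measurable_cons_prod.
  by move=> z _; rewrite lee_fin normrM ler_piMl ?cos_max.
(* For fixed [s] the inner integral is a line transform at frequency parameter
   [y0 + schur_shift K y1]. The part of the form that does not involve the first coordinate joins
   [th] in the phase, which is why an additive phase is carried through the induction. *)
transitivity (\int[lam n]_s ((Num.sqrt (2 * pi / K 0 0) *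
     expR (- 2^-1 * (K 0 0 * (y0 + schur_shift K y1) ^+ 2)))%:E *
   (cos (bform (schur K) y1 (col_tuple s) + th) *
     mgaussian (schur K) (col_tuple s))%:E))%E.
  apply: eq_integral => s _; rewrite -EFinM mulrA
    -(integral_gaussian_cosE _ (- schur_shift K (col_tuple s)))//.
  apply: eq_integral => x _; rewrite col_tuple_cons mgaussian_cons// bform_schur//.
  by rewrite opprK addrA.
rewrite integralZl//; last first.
  apply: (le_integrable _ _ _ IHi) => //.
    by apply/measurable_EFinP; exact: measurable_mgaussian_cos.
  by move=> z _; rewrite lee_fin normrM ler_piMl ?cos_max.
rewrite IHc -EFinM mgaussian_massS//; congr (_%:E).
rewrite mgaussian_cons//.
by rewrite /gaussian opprK; ring.
Qed.

End GaussianTupleIntegral.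

(** * Integration on matrices *)

Section Density.
Context {disp} {T : measurableType disp} {R : realType}.

(** The density, extended by 0 outside [D], has the same integrals over measurable sets as the
    Radon-Nikodym derivative of [nu] and hence equals it almost everywhere; the change of variables
    for that derivative concludes. *)
Lemma ge0_integral_density (mu nu : probability T R) (D : set T) (g : T -> R) :
  measurable D -> measurable_fun setT g -> (forall x, 0 <= g x) ->
  (forall S, measurable S -> nu S = \int[mu]_(x in D `&` S) (g x)%:E)%E ->
  forall f : T -> R, measurable_fun setT f -> (forall x, 0 <= f x) ->
  (\int[nu]_x (f x)%:E = \int[mu]_(x in D) (f x * g x)%:E)%E.
Proof.
move=> mD mg g0 nuE f mf f0.
pose h := (EFin \o g) \_ D.
have mh : measurable_fun setT h.
  apply: (measurable_restrictT _ mD).1; apply: measurable_funTS.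
  exact/measurable_EFinP.
have h0 x : (0 <= h x)%E by rewrite /h patchE; case: ifP => // _; rewrite lee_fin.
have nuh S : measurable S -> nu S = (\int[mu]_(x in S) h x)%E.
  by move=> mS; rewrite nuE// setIC integral_mkcondr.
have ih : mu.-integrable setT h.
  apply/integrableP; split=> //.
  under eq_integral do rewrite gee0_abs//.
  by rewrite -nuh// (le_lt_trans (probability_le1 _ _))// ltry.
have dom : nu `<< mu.
  apply/null_content_dominatesP => A mA muA0; rewrite nuh//.
  by apply: null_set_integral => //; exact: measurable_funTS.
have aeh : ae_eq mu setT h (Radon_Nikodym_SigmaFinite.f nu mu).
  apply: integral_ae_eq => //.
    exact: measurable_int (Radon_Nikodym_SigmaFinite.f_integrable dom).
  by move=> A _ mA; rewrite -nuh// -Radon_Nikodym_SigmaFinite.f_integral.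
rewrite -(Radon_Nikodym_SigmaFinite.change_of_variables dom)//; first last.
  exact/measurable_EFinP.
rewrite [RHS]integral_mkcond.
have mRN := measurable_int _ (Radon_Nikodym_SigmaFinite.f_integrable dom).
rewrite [LHS](ae_eq_integral (fun x => (f x)%:E * h x)%E).
- apply: eq_integral => x _; rewrite /h !patchE; case: ifP => // _.
  exact: mule0.
- by [].
- by apply: emeasurable_funM => //; exact/measurable_EFinP.
- by apply: emeasurable_funM => //; exact/measurable_EFinP.
- by move: aeh; apply: filterS => x /= /(_ I) hx _; rewrite hx.
Qed.

(** Infinite [x] is covered as well: [fine] sends infinities to 0, and a positive factor keeps them
    infinite. Constants can thus be pulled out of real integrals of nonnegative functions even when
    these diverge. *)
Lemma fineM_ge0l (c : R) (x : \bar R) : 0 <= c -> fine (c%:E * x) = c * fine x.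
Proof.
rewrite le_eqVlt => /predU1P[<-|c0]; first by rewrite mul0e !mul0r.
by case: x => [x| |]; [|rewrite gt0_muley ?mulr0|rewrite gt0_muleNy ?mulr0].
Qed.

Lemma ge0_RintegralZl (mu : {measure set T -> \bar R}) (D : set T) (c : R)
    (f : T -> R) :
  measurable D -> measurable_fun D f -> (forall x, D x -> 0 <= f x) -> 0 <= c ->
  \int[mu]_(x in D) (c * f x) = c * \int[mu]_(x in D) f x.
Proof.
move=> mD mf f0 c0; rewrite /Rintegral -fineM_ge0l// -ge0_integralZl//.
  exact/measurable_EFinP.
Qed.

End Density.

Section MatrixMeasurability.
Context {R : realType} {d p : nat}.
Local Notation M := 'M[R]_(d, p).

Lemma measurable_mx_coord i j : measurable_fun setT (fun x : M => x i j).
Proof.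
apply: (measurability _ (RGenOInfty.measurableE R)) => //.
move=> /= _ [_ [a ->] <-]; rewrite setTI; apply: sub_sigma_algebra.
have /continuousP := @coord_continuous R d p i j; apply.
exact: interval_open.
Qed.

Lemma vecE (x : M) i j : vec x (mxvec_index i j) 0 = x j i.
Proof. by rewrite /vec mxE mxvecE mxE. Qed.

Lemma measurable_vec_coord {disp} {T : measurableType disp} (f : T -> M) k :
  (forall i j, measurable_fun setT (fun x => f x i j)) ->
  measurable_fun setT (fun x => vec (f x) k 0).
Proof.
move=> mf; case/mxvec_indexP: k => i j.
by under eq_fun do rewrite vecE; exact: mf.
Qed.

Lemma measurable_mxtrace_mul {disp} {T : measurableType disp} (f g : T -> M) :
  (forall i j, measurable_fun setT (fun x => f x i j)) ->
  (forall i j, measurable_fun setT (fun x => g x i j)) ->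
  measurable_fun setT (fun x => \tr ((f x)^T *m g x)).
Proof.
move=> mf mg.
have -> : (fun x => \tr ((f x)^T *m g x)) =
    (fun x => \sum_i \sum_j f x j i * g x j i).
  apply/funext => x; apply: eq_bigr => i _; rewrite mxE.
  by apply: eq_bigr => j _; rewrite mxE.
by apply: measurable_sum => i; apply: measurable_sum => j; apply: measurable_funM.
Qed.

Lemma measurable_stiefel : measurable (@stiefel R d p).
Proof.
have -> : @stiefel R d p = \bigcap_(ij in [set: 'I_p * 'I_p])
    (fun x : M => (x^T *m x) ij.1 ij.2) @^-1` [set (1%:M : 'M[R]_p) ij.1 ij.2].
  apply/seteqP; split => x; first by rewrite /stiefel/= => xx [i j] _ /=; rewrite xx.
  by move=> h; apply/matrixP => i j; exact: (h (i, j) I).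
apply: fin_bigcap_measurable; first exact: finite_finset.
move=> [i j] _; rewrite -[X in measurable X]setTI.
suff mf : measurable_fun setT (fun x : M => (x^T *m x) i j).
  by apply: mf => //; exact: measurable_set1.
have -> : (fun x : M => (x^T *m x) i j) = (fun x => \sum_k x k i * x k j).
  by apply/funext => x; rewrite mxE; apply: eq_bigr => k _; rewrite mxE.
apply: measurable_sum => k.
by apply: measurable_funM; exact: measurable_mx_coord.
Qed.

Lemma mxtrace_vec (x y : M) : \tr (x^T *m y) = ((vec x)^T *m vec y) 0 0.
Proof.
transitivity (\sum_i \sum_j x j i * y j i).
  by apply: eq_bigr => i _; rewrite mxE; apply: eq_bigr => j _; rewrite mxE.
rewrite [RHS]mxE (reindex _ (curry_mxvec_bij p d)) /= pair_bigA /=.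
by apply: eq_bigr => -[i j] _ /=; rewrite [(vec x)^T _ _]mxE !vecE.
Qed.

End MatrixMeasurability.

Section LebesgueMatrixSigmaFinite.
Context {R : realType} (d p : nat).
Local Notation tup n := (n.-tuple (measurableTypeR R)).

Lemma vec_unvec_tuple (s : tup (p * d)) : vec (@unvec_tuple R d p s) = col_tuple s.
Proof. exact: unvecK. Qed.

Lemma sigma_finite_lebesgue_mx : sigma_finite setT (@lebesgue_mx R d p).
Proof.
pose C c : set 'M[R]_(d, p) :=
  \bigcap_(k in [set: 'I_(p * d)]) (fun x => vec x k 0) @^-1` `[- c%:R, c%:R].
have CE c : @unvec_tuple R d p @^-1` C c = @cube R (p * d) c.
  apply/seteqP; split => s /= h k _ /=; have := h k I => /=;
    by rewrite vec_unvec_tuple mxE.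
exists C.
  apply/esym/seteqP; split => // x _.
  exists (\sum_(k < p * d) (Num.truncn `|vec x k 0|).+1) => // k _.
  rewrite /= in_itv/= -ler_norml.
  apply: (le_trans (ltW (truncnS_gt _))); rewrite ler_nat.
  by rewrite (bigD1 k)//= leq_addr.
move=> c; split; last by rewrite /= /pushforward CE lebesgue_tuple_cube_lty.
apply: fin_bigcap_measurable; first exact: finite_finset.
move=> k _; rewrite -[X in measurable X]setTI.
by apply: measurable_vec_coord => //; exact: measurable_mx_coord.
Qed.

(** As with [lebesgue_tuple_fun], a named copy that carries the sigma-finite structure used by
    Fubini. *)
Definition lebesgue_mx_fun : set 'M[R]_(d, p) -> \bar R := @lebesgue_mx R d p.

HB.instance Definition _ := Measure.copy lebesgue_mx_fun (@lebesgue_mx R d p).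

HB.instance Definition _ := Measure_isSigmaFinite.Build _ _ _
  lebesgue_mx_fun sigma_finite_lebesgue_mx.

End LebesgueMatrixSigmaFinite.

(** * The cosine transform of the weight function *)

Section WeightTransform.
Context {R : realType} {d p : nat}.
Variable Omega : 'M[R]_(p * d).
Hypotheses (Os : Omega^T = Omega) (Op : posdefmx Omega).
Local Notation M := 'M[R]_(d, p).
Local Notation lam := (@lebesgue_mx_fun R d p).

(** The mass for the precision [invmx Omega] is the square root of
    [(2 * pi) ^+ (p * d) * \det Omega]; its real powers cancel those of the prefactor once [d * p]
    and [p * d] are identified. *)
Lemma weight_normalized :
  (2 * pi) `^ (- ((d * p)%:R / 2)) * \det Omega `^ (- 2^-1) *
    mgaussian_mass (invmx Omega) = 1.
Proof.
have D0 := posdef_det_gt0 _ _ Os Op.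
have pi0 : 0 < 2 * pi :> R by rewrite mulr_gt0// pi_gt0.
rewrite /mgaussian_mass det_inv invrK -powR12_sqrt; last first.
  by rewrite mulr_ge0 ?(ltW D0)// exprn_ge0// ltW.
rewrite [X in _ * X]powRM ?(ltW D0) ?exprn_ge0 ?(ltW pi0)//.
rewrite -(powR_mulrn _ (ltW pi0)) -(powRrM (2 * pi)) [(d * p)%N]mulnC.
rewrite mulrACA -!powRD ?subrr ?addNr ?powRr0 ?mulr1//.
- by rewrite (gt_eqF D0) implybT.
- by rewrite (gt_eqF pi0) implybT.
Qed.

Lemma weightE (t : M) : weight Omega t =
  (2 * pi) `^ (- ((d * p)%:R / 2)) * \det Omega `^ (- 2^-1) *
    mgaussian (invmx Omega) (vec t).
Proof. by []. Qed.

Lemma measurable_weight : measurable_fun setT (weight Omega : M -> R).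
Proof.
apply: measurable_funM => //; apply: (@measurableT_comp _ _ _ _ _ _ (@expR R)) => //.
apply: measurable_funM => //; rewrite /qform.
apply: (measurable_bform _ (invmx Omega)) => k;
  apply: measurable_vec_coord; exact: measurable_mx_coord.
Qed.

Lemma measurable_mxtrace_cst (z : M) :
  measurable_fun setT (fun t : M => \tr (t^T *m z)).
Proof.
by apply: measurable_mxtrace_mul => i j //; exact: measurable_mx_coord.
Qed.

Lemma measurable_cos_weight (z : M) :
  measurable_fun setT (fun t : M => cos (\tr (t^T *m z)) * weight Omega t).
Proof.
apply: measurable_funM; last exact: measurable_weight.
apply: (measurableT_comp (continuous_measurable_fun (@continuous_cos R))).
exact: measurable_mxtrace_cst.
Qed.

Lemma integrable_weight : lam.-integrable setT (EFin \o weight Omega).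
Proof.
have [ig _] := integral_mgaussian_cos _ _ (invmx_sym _ Os) (posdef_invmx _ Os Op).
have mw : measurable_fun setT (EFin \o (weight Omega : M -> R)).
  by apply/measurable_EFinP; exact: measurable_weight.
refine (@integrable_pushforward _ _ _ _ _ _ (@measurable_unvec_tuple R d p)
  (@lebesgue_tuple R (p * d)) setT (EFin \o weight Omega) mw _ measurableT).
set c := (2 * pi) `^ (- ((d * p)%:R / 2)) * \det Omega `^ (- 2^-1).
rewrite (_ : _ \o _ = (fun s => c%:E *
    (mgaussian (invmx Omega) (col_tuple s))%:E)%E).
  exact: (integrableZl measurableT c ig).
by apply/funext => s; rewrite /= weightE vec_unvec_tuple.
Qed.

Lemma integrable_cos_weight (z : M) :
  lam.-integrable setT (fun t => (cos (\tr (t^T *m z)) * weight Omega t)%:E).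
Proof.
apply: (le_integrable _ _ _ integrable_weight) => //.
  by apply/measurable_EFinP; exact: measurable_cos_weight.
by move=> t _; rewrite lee_fin normrM ler_piMl ?cos_max.
Qed.

(** This is the characteristic function of the centered Gaussian with covariance [Omega]. It follows
    from the transform on tuples with precision [invmx Omega] and frequency written as [invmx Omega]
    applied to [Omega *m vec z]. *)
Lemma integral_cos_weight (z : M) :
  (\int[lam]_t (cos (\tr (t^T *m z)) * weight Omega t)%:E =
   (expR (- 2^-1 * qform Omega (vec z)))%:E)%E.
Proof.
have [ig ic] := integral_mgaussian_cos _ _ (invmx_sym _ Os) (posdef_invmx _ Os Op).
set c := (2 * pi) `^ (- ((d * p)%:R / 2)) * \det Omega `^ (- 2^-1).
have FE s : cos (\tr ((@unvec_tuple R d p s)^T *m z)) * weight Omega (unvec_tuple s) =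
    c * (cos (bform (invmx Omega) (Omega *m vec z) (col_tuple s) + 0) *
         mgaussian (invmx Omega) (col_tuple s)).
  rewrite weightE vec_unvec_tuple -/c mulrCA; congr (_ * (cos _ * _)).
  rewrite addr0 bform_invmx// -vec_unvec_tuple -mxtrace_vec -mxtrace_tr.
  by rewrite trmx_mul trmxK.
have ip := @integral_pushforward _ _ _ _ _ _ (@measurable_unvec_tuple R d p)
  (@lebesgue_tuple R (p * d)) setT
  (EFin \o (fun t => cos (\tr (t^T *m z)) * weight Omega t)).
rewrite [LHS]ip//.
- rewrite preimage_setT; under eq_integral do rewrite /= FE EFinM.
  rewrite integralZl//.
    rewrite [X in (_ * X)%E]ic cos0 mulr1 -EFinM mulrA weight_normalized mul1r.
    by rewrite /mgaussian qform_invmx.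
  apply: (le_integrable _ _ _ ig) => //.
    by apply/measurable_EFinP; exact: measurable_mgaussian_cos.
  by move=> s _; rewrite lee_fin normrM ler_piMl ?cos_max.
- by apply/measurable_EFinP; exact: measurable_cos_weight.
- rewrite preimage_setT.
  rewrite (_ : _ \o _ = (fun s => c%:E * (cos (bform (invmx Omega)
     (Omega *m vec z) (col_tuple s) + 0) *
         mgaussian (invmx Omega) (col_tuple s))%:E)%E); last first.
    by apply/funext => s; rewrite /= FE EFinM.
  apply: (integrableZl measurableT).
  apply: (le_integrable _ _ _ ig) => //.
    by apply/measurable_EFinP; exact: measurable_mgaussian_cos.
  by move=> s _; rewrite lee_fin normrM ler_piMl ?cos_max.
Qed.

End WeightTransform.

(** * The statistics [U1] and [U2] *)

Section EmpiricalTransform.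
Context {R : realType} {d p : nat}.
Local Notation M := 'M[R]_(d, p).

Lemma Re_sum (I : finType) (F : I -> R[i]) :
  complex.Re (\sum_i F i) = \sum_i complex.Re (F i).
Proof. by apply: (big_morph (@complex.Re R)) => // -[a b] [a' b']. Qed.

Lemma Im_sum (I : finType) (F : I -> R[i]) :
  complex.Im (\sum_i F i) = \sum_i complex.Im (F i).
Proof. by apply: (big_morph (@complex.Im R)) => // -[a b] [a' b']. Qed.

Lemma cexp_i (a : R) : cexp ('i%C * a%:C%C) = Complex (cos a) (sin a).
Proof.
have -> : 'i%C * a%:C%C = Complex 0 a.
  by rewrite /GRing.mul /= !mul0r !mul1r subr0 add0r.
by rewrite /cexp /= expR0 !mul1r.
Qed.

Lemma natC_inv n : (n%:R : R[i])^-1 = (n%:R^-1 : R)%:C%C.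
Proof. by rewrite -(rmorph_nat (real_complex R)) -fmorphV. Qed.

Lemma phinE n (x : 'I_n -> M) t : phin x t =
  Complex (n%:R^-1 * \sum_j cos (\tr (t^T *m x j)))
          (n%:R^-1 * \sum_j sin (\tr (t^T *m x j))).
Proof.
rewrite /phin natC_inv; under eq_bigr do rewrite cexp_i.
rewrite [X in _ * X = _](_ : _ = Complex (\sum_j cos (\tr (t^T *m x j)))
   (\sum_j sin (\tr (t^T *m x j)))).
  by rewrite /GRing.mul /= !mul0r subr0 addr0.
by apply/eqP; rewrite eq_complex /= Re_sum Im_sum !eqxx.
Qed.

Lemma Rintegral_sum {disp} {T : measurableType disp}
    (mu : {measure set T -> \bar R}) (I : finType) (f : I -> T -> R) :
  (forall i, mu.-integrable setT (EFin \o f i)) ->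
  \int[mu]_x (\sum_i f i x) = \sum_i \int[mu]_x f i x.
Proof.
move=> fi; rewrite /Rintegral; under eq_integral do rewrite -sumEFin.
rewrite integral_sum//.
have -> : (\sum_i \int[mu]_x (f i x)%:E = \sum_i (\int[mu]_x f i x)%R%:E)%E.
  by apply: eq_bigr => i _; rewrite fineK//; exact: integrable_fin_num (fi i).
by rewrite sumEFin.
Qed.

Lemma normc_phin_sqr n (x : 'I_n -> M) t :
  ComplexField.Normc.normc (phin x t) ^+ 2 =
  (n%:R ^+ 2)^-1 * \sum_j \sum_k cos (\tr (t^T *m (x j - x k))).
Proof.
rewrite phinE /ComplexField.Normc.normc sqr_sqrtr ?addr_ge0 ?sqr_ge0//.
rewrite !exprMn -mulrDr exprVn; congr (_ * _).
rewrite !expr2 !mulr_suml -big_split /=; apply: eq_bigr => j _.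
rewrite !mulr_sumr -big_split /=; apply: eq_bigr => k _.
by rewrite mulmxBr linearB /= cosB.
Qed.

Variable Omega : 'M[R]_(p * d).
Hypotheses (Os : Omega^T = Omega) (Op : posdefmx Omega).

Lemma U1E n (x : 'I_n -> M) :
  U1 Omega x = (n%:R ^+ 2)^-1 * \sum_j \sum_k
    expR (- 2^-1 * qform Omega (vec (x j - x k))).
Proof.
pose lam := @lebesgue_mx_fun R d p.
have ii z := integrable_cos_weight _ Os Op z.
rewrite /U1; transitivity (\int[lam]_t ((n%:R ^+ 2)^-1 *
    \sum_(jk : 'I_n * 'I_n) (cos (\tr (t^T *m (x jk.1 - x jk.2))) * weight Omega t))).
  apply: eq_Rintegral => t _; rewrite normc_phin_sqr -mulrA; congr (_ * _).
  by rewrite pair_bigA mulr_suml.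
rewrite RintegralZl//; last first.
  rewrite /comp; under eq_fun do rewrite -sumEFin.
  by apply: integrable_sum => // jk _; exact: ii.
rewrite Rintegral_sum; last by move=> jk; exact: ii.
rewrite pair_bigA; congr (_ * _); apply: eq_bigr => jk _.
by rewrite /Rintegral integral_cos_weight.
Qed.

End EmpiricalTransform.

Section TransformPairing.
Context {R : realType} {d p : nat}.
Local Notation M := 'M[R]_(d, p).
Local Notation lam := (@lebesgue_mx_fun R d p).
Variable P0 : probability M R.

Lemma integrable_bounded_wave (f : R -> R) (t : M) :
  measurable_fun setT f -> (forall a, `|f a| <= 1) ->
  P0.-integrable setT (fun x => (f (\tr (t^T *m x)))%:E).
Proof.
move=> mf f1.
apply: (le_integrable _ _ _ (finite_measure_integrable_cst P0 1 measurableT)) => //.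
  apply/measurable_EFinP; apply: (measurableT_comp mf).
  by apply: measurable_mxtrace_mul => i j //; exact: measurable_mx_coord.
by move=> x _; rewrite lee_fin normr1.
Qed.

Let icos t := integrable_bounded_wave cos t
  (continuous_measurable_fun (@continuous_cos R)) (@cos_max R).
Let isin t := integrable_bounded_wave sin t
  (continuous_measurable_fun (@continuous_sin R)) (@sin_max R).

Lemma phi0E t : phi0 P0 t =
  Complex (\int[P0]_x cos (\tr (t^T *m x))) (\int[P0]_x sin (\tr (t^T *m x))).
Proof.
by rewrite /phi0 /Cintegral; congr Complex; apply: eq_Rintegral => x _;
  rewrite cexp_i.
Qed.

(** The right side is the real part of [phi0 P0 t] times the conjugate of the character of [z] at
    [t]; the subtraction formula for the cosine puts both under one integral. *)
Lemma integral_cos_sub (t z : M) :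
  \int[P0]_x cos (\tr (t^T *m (x - z))) =
  (\int[P0]_x cos (\tr (t^T *m x))) * cos (\tr (t^T *m z)) +
  (\int[P0]_x sin (\tr (t^T *m x))) * sin (\tr (t^T *m z)).
Proof.
rewrite -(RintegralZr _ measurableT (icos t)) -(RintegralZr _ measurableT (isin t)).
rewrite -RintegralD//.
- by apply: eq_Rintegral => x _; rewrite mulmxBr linearB /= cosB.
- exact: (integrableZr measurableT _ (icos t)).
- exact: (integrableZr measurableT _ (isin t)).
Qed.

Variable Omega : 'M[R]_(p * d).
Hypotheses (Os : Omega^T = Omega) (Op : posdefmx Omega).

(** Supplies the hypothesis of Fubini: the integrand is dominated by the weight of the first
    variable, and integrating this over the probability [P0] changes nothing. *)
Lemma integrable_shift_weight (z : M) : (lam \x P0)%E.-integrable setT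
  (fun tx => (cos (\tr (tx.1^T *m (tx.2 - z))) * weight Omega tx.1)%:E).
Proof.
have iw : (lam \x P0)%E.-integrable setT (fun tx => (weight Omega tx.1)%:E).
  have mw : measurable_fun setT (fun tx : M * M => (weight Omega tx.1)%:E).
    apply/measurable_EFinP; apply: (measurableT_comp (measurable_weight Omega)).
    exact: measurable_fst.
  refine ((@integrable12ltyP _ _ _ _ _ lam P0 _ mw).2 _).
  rewrite (eq_integral (fun t => `|(weight Omega t)%:E|%E)); last first.
    move=> t _; rewrite /= (integral_cst P0 measurableT (`|weight Omega t|%:E)).
    by rewrite [X in (_ * X)%E]probability_setT mule1.
  by have /integrableP[] := integrable_weight Omega Os Op.
apply: (le_integrable _ _ _ iw) => //.
  apply/measurable_EFinP; apply: measurable_funM; last first.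
    apply: (measurableT_comp (measurable_weight Omega)); exact: measurable_fst.
  apply: (measurableT_comp (continuous_measurable_fun (@continuous_cos R))).
  apply: measurable_mxtrace_mul => i j.
    exact: (measurableT_comp (measurable_mx_coord i j) measurable_fst).
  under eq_fun do rewrite !mxE.
  apply: measurable_funB => //.
  exact: (measurableT_comp (measurable_mx_coord i j) measurable_snd).
by move=> t _; rewrite lee_fin normrM ler_piMl ?cos_max.
Qed.

Let inner z t : (\int[P0]_x (cos (\tr (t^T *m (x - z))) * weight Omega t)%:E =
  (\int[P0]_x cos (\tr (t^T *m (x - z))) * weight Omega t)%R%:E)%E.
Proof.
have ic : P0.-integrable setT (fun x => (cos (\tr (t^T *m (x - z))))%:E).
  under eq_fun do rewrite mulmxBr linearB /=.
  apply: (le_integrable _ _ _ (finite_measure_integrable_cst P0 1 measurableT)) => //.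
    apply/measurable_EFinP.
    apply: (measurableT_comp (continuous_measurable_fun (@continuous_cos R))).
    apply: measurable_funB => //.
    by apply: measurable_mxtrace_mul => i j //; exact: measurable_mx_coord.
  by move=> x _; rewrite lee_fin normr1 cos_max.
under eq_integral do rewrite EFinM.
by rewrite integralZr// EFinM fineK//; exact: integrable_fin_num.
Qed.

Lemma integrable_cos_shift z : lam.-integrable setT
  (fun t => ((\int[P0]_x cos (\tr (t^T *m (x - z)))) * weight Omega t)%:E).
Proof.
have := integrable_fubini_F (integrable_shift_weight z).
by rewrite /fubini_F; under eq_fun do rewrite inner.
Qed.

Lemma integral_cos_shift z :
  \int[lam]_t ((\int[P0]_x cos (\tr (t^T *m (x - z)))) * weight Omega t) =
  \int[P0]_x expR (- 2^-1 * qform Omega (vec (x - z))).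
Proof.
rewrite /Rintegral; congr fine; under eq_integral do rewrite -inner.
rewrite (Fubini (integrable_shift_weight z)) /=.
by apply: eq_integral => x _; rewrite integral_cos_weight.
Qed.

Lemma U2E n (x : 'I_n -> M) :
  U2 Omega P0 x = n%:R^-1 * \sum_j
    \int[P0]_y expR (- 2^-1 * qform Omega (vec (y - x j))).
Proof.
rewrite /U2 /Cintegral /=.
transitivity (\int[lam]_t (n%:R^-1 * \sum_j
    ((\int[P0]_y cos (\tr (t^T *m (y - x j)))) * weight Omega t))).
  apply: eq_Rintegral => t _; rewrite phi0E phinE /= !mulr0 subr0.
  (* Taking the real part of the product with the conjugate leaves cosine times cosine plus sine
     times sine, which is recombined term by term over the sample. *)
  rewrite [X in _ = _ * X](eq_bigr _ (fun j _ =>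
    congr1 ( *%R^~ (weight Omega t)) (integral_cos_sub t (x j)))).
  by rewrite -mulr_suml big_split /= -!mulr_sumr; ring.
rewrite RintegralZl//; last first.
  rewrite /comp; under eq_fun do rewrite -sumEFin.
  by apply: integrable_sum => // j _; exact: integrable_cos_shift.
rewrite Rintegral_sum; last by move=> j; exact: integrable_cos_shift.
by congr (_ * _); apply: eq_bigr => j _; exact: integral_cos_shift.
Qed.

End TransformPairing.

(** * Gaussian integrals against the Fisher-Bingham distribution *)

Section FisherBinghamIntegral.
Context {R : realType} {d p : nat}.
Local Notation M := 'M[R]_(d, p).

Lemma fb_kernel_ge0 (A : M) B x : 0 <= fb_kernel A B x.
Proof. exact: expR_ge0. Qed.

Lemma measurable_fb_kernel (A : M) B : measurable_fun setT (fb_kernel A B).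
Proof.
apply: (@measurableT_comp _ _ _ _ _ _ (@expR R)) => //.
apply: measurable_funD.
  by apply: measurable_mxtrace_mul => i j //; exact: measurable_mx_coord.
by apply: (measurable_bform _ B) => k; apply: measurable_vec_coord;
  exact: measurable_mx_coord.
Qed.

(* Completing the square: the Gaussian factor is absorbed by the kernel. *)
Lemma gauss_fb_kernel (A z x : M) (B Omega : 'M[R]_(p * d)) : Omega^T = Omega ->
  expR (- 2^-1 * qform Omega (vec (x - z))) * fb_kernel A B x =
  expR (- 2^-1 * qform Omega (vec z)) *
    fb_kernel (unvec (vec A + Omega *m vec z)) (B - 2^-1 *: Omega) x.
Proof.
move=> Os; rewrite /fb_kernel -!expRD; congr expR.
have -> : vec (x - z) = vec x + - vec z by rewrite /vec !linearB.
rewrite qformD// !mxtrace_vec unvecK.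
have -> : qform (B - 2^-1 *: Omega) (vec x) =
    qform B (vec x) - 2^-1 * qform Omega (vec x).
  by rewrite /qform mulmxBr mulmxBl -scalemxAr -scalemxAl !mxE.
have -> : ((vec A + Omega *m vec z)^T *m vec x) 0 0 =
    ((vec A)^T *m vec x) 0 0 + bform Omega (vec x) (vec z).
  by rewrite linearD /= mulmxDl mxE trmx_mul Os [bform _ _ _]bformC.
have -> : qform Omega (- vec z) = qform Omega (vec z).
  by rewrite /qform [(- vec z)^T]linearN /= mulmxN !mulNmx opprK.
have -> : bform Omega (vec x) (- vec z) = - bform Omega (vec x) (vec z).
  by rewrite /bform mulmxN mxE.
by field.
Qed.

(** Passing to the density turns the left side into an integral over the Stiefel manifold. There
    [gauss_fb_kernel] produces a new kernel, whose integral is [Psi_vec], times a factor that does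
    not depend on the integration variable. *)
Lemma fisher_bingham_integral (eta P0 : probability M R) (A z : M)
    (B Omega : 'M[R]_(p * d)) :
  Omega^T = Omega -> is_fisher_bingham eta A B P0 ->
  \int[P0]_x expR (- 2^-1 * qform Omega (vec (x - z))) =
  (Psi eta A B)^-1 * (expR (- 2^-1 * qform Omega (vec z)) *
    Psi_vec eta (vec A + Omega *m vec z) (B - 2^-1 *: Omega)).
Proof.
move=> Os hP0.
have Psi0 : 0 <= (Psi eta A B)^-1.
  by rewrite invr_ge0 Rintegral_ge0// => x _; exact: fb_kernel_ge0.
rewrite /Rintegral (ge0_integral_density _ _ _ _ measurable_stiefel _ _ hP0)//.
- rewrite mulrA /Psi_vec /Psi -ge0_RintegralZl//; first last.
  + by rewrite mulr_ge0// expR_ge0.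
  + by move=> x _; exact: fb_kernel_ge0.
  + by apply: measurable_funTS; exact: measurable_fb_kernel.
  + exact: measurable_stiefel.
  apply: eq_Rintegral => x _.
  by rewrite /fb_density mulrCA gauss_fb_kernel// mulrA.
- by apply: measurable_funM => //; exact: measurable_fb_kernel.
- by move=> x; rewrite mulr_ge0// fb_kernel_ge0.
- apply: (@measurableT_comp _ _ _ _ _ _ (@expR R)) => //.
  apply: measurable_funM => //.
  apply: (measurable_bform _ Omega) => k; apply: measurable_vec_coord => i j;
  under eq_fun do rewrite !mxE; apply: measurable_funB => //;
  exact: measurable_mx_coord.
Qed.

End FisherBinghamIntegral.

Theorem theorem3p1 (R : realType) (d p n : nat)
    (hp : (1 <= p)%N) (hpd : (p <= d)%N) (hn : (1 <= n)%N)
    (A : 'M[R]_(d, p)) (B : 'M[R]_(p * d)) (hB : B^T = B)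
    (Omega : 'M[R]_(p * d)) (hOs : Omega^T = Omega) (hOp : posdefmx Omega)
    (eta : probability 'M[R]_(d, p) R) (heta : is_stiefel_haar eta)
    (P0 : probability 'M[R]_(d, p) R) (hP0 : is_fisher_bingham eta A B P0)
    (q : measure_display) (T : measurableType q) (P : probability T R)
    (X : 'I_n -> {RV P >-> 'M[R]_(d, p)}) (hX : random_sample_in X stiefel) :
  forall w : T,
    U1 Omega (fun j => X j w) =
      (n%:R ^+ 2)^-1 * \sum_(j < n) \sum_(k < n)
        expR (- 2^-1 * qform Omega (vec (X j w - X k w)))
    /\
    U2 Omega P0 (fun j => X j w) =
      (n%:R * Psi eta A B)^-1 * \sum_(j < n)
        (expR (- 2^-1 * qform Omega (vec (X j w))) *
         Psi_vec eta (vec A + Omega *m vec (X j w)) (B - 2^-1 *: Omega)).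
Proof.
(* Both identities hold for each outcome [w], with the sample points treated as fixed matrices. *)
move=> w; split; first exact: U1E.
rewrite U2E// invfM -mulrA; congr (_ * _); rewrite mulr_sumr.
by apply: eq_bigr => j _; exact: fisher_bingham_integral.
Qed.
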